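(* Let $\alpha>0$, let $B\in\mathbb{R}^{n\times n}$ be a symmetric irreducible $M$-matrix, and let $f(y)=\frac{\alpha}{2}\sum_{i=1}^n y_i^4+y^TBy$. Let $D>1$, let $(y^0,w^0)\in\mathbb{R}^n\times\mathbb{R}^n$ be any initial point, and let $L_f$ be a Lipschitz constant of $\nabla f$ on $\{y\in\mathbb{R}^n:\|y\|\le D\}$. If $$\rho>\max\Big\{\frac{\|w^0\|-2D\lambda_{\min}(B)}{D-1},\ \frac{2D^3\alpha+2D(\lambda_{\max}(B)-\lambda_{\min}(B))}{D-1},\ 2(L_f+1),\ 2\alpha+2\lambda_{\max}(B)\Big\},$$ then the sequence $\{(x^k,y^k,w^k)\}$ generated by the standard ADMM (described in the context) with parameter $\rho$ converges to some $(x^*,y^*,w^* )$, and $y^*$ is a global minimizer of $$\min_{x\in\mathbb{R}^n}\ \frac{\alpha}{2}\sum_{i=1}^n x_i^4+x^TBx\quad\text{s.t. }\|x\|_2^2=1 .$$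
   Context: $\|\cdot\|$ is the Euclidean norm; $\lambda_{\min}(B),\lambda_{\max}(B)$ are the smallest and largest eigenvalues of $B$. A matrix $B$ is reducible if there is a nonempty proper subset $I\subset\{1,\dots,n\}$ with $b_{ij}=0$ for all $i\in I$, $j\notin I$; otherwise irreducible. $B$ is an $M$-matrix if $B=sI-A$ with $A$ entrywise nonnegative and $s\ge\rho(A)$ (here $\rho(A)$ denotes the spectral radius of $A$, not to be confused with the ADMM parameter $\rho$). Standard ADMM: let $\mathcal{S}=\{x\in\mathbb{R}^n:\|x\|=1,\ x\ge0\}$ (entrywise inequality) and let $\mathrm{Proj}_{\mathcal{S}}(v)=\arg\min_{x\in\mathcal{S}}\|x-v\|$ (which may be set-valued, in which case any element may be chosen). Given $(y^0,w^0)$ and $\rho$, for $k=0,1,2,\dots$: $$x^{k+1}\in\mathrm{Proj}_{\mathcal{S}}\big(y^k-\tfrac{w^k}{\rho}\big),$$ $$y^{k+1}=\arg\min_{y\in\mathbb{R}^n}\Big(f(y)+(w^k)^T(x^{k+1}-y)+\tfrac{\rho}{2}\|x^{k+1}-y\|^2\Big),$$ $$w^{k+1}=w^k+\rho(x^{k+1}-y^{k+1}).$$ *)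

(* Defs.v *)
From HB Require Import structures.
From mathcomp Require Import all_boot all_order all_algebra.
From mathcomp Require Import all_classical all_reals all_analysis.
From mathcomp Require Import complex.

Set Implicit Arguments.
Unset Strict Implicit.
Unset Printing Implicit Defensive.

Import Order.TTheory GRing.Theory Num.Theory.
Import numFieldNormedType.Exports.

Local Open Scope classical_set_scope.
Local Open Scope ring_scope.

Definition argmin (T : Type) (R : realType) (g : T -> R) (A : set T) : set T :=
  [set a | A a /\ forall b, A b -> g a <= g b].

Definition dotv (R : realType) (n : nat) (u v : 'cV[R]_n) : R :=
  (u^T *m v) 0 0.

(* The norm `|x| of the library is the sup norm. *)
Definition enorm (R : realType) (n : nat) (x : 'cV[R]_n) : R :=
  Num.sqrt (\sum_(i < n) x i 0 ^+ 2).

Definition grad (R : realType) (n : nat) (f : 'cV[R]_n -> R) (y : 'cV[R]_n) :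
    'cV[R]_n :=
  \col_(i < n) 'D_(delta_mx i 0) f y.

(* [k.-lipschitz_A] of the library would be relative to the sup norm. *)
Definition lipschitz_const (R : realType) (n : nat) (A : set 'cV[R]_n)
    (g : 'cV[R]_n -> 'cV[R]_n) (L : R) : Prop :=
  forall y z, A y -> A z -> enorm (g y - g z) <= L * enorm (y - z).

(* For B symmetric of positive size, the set of its eigenvalues is finite and
   nonempty, so that the inf and the sup are its least and largest elements. *)
Definition lambda_min (R : realType) (n : nat) (B : 'M[R]_n) : R :=
  inf [set a : R | eigenvalue B a].

Definition lambda_max (R : realType) (n : nat) (B : 'M[R]_n) : R :=
  sup [set a : R | eigenvalue B a].

Definition spectral_radius (R : realType) (n : nat) (A : 'M[R]_n) : R :=
  sup [set ComplexField.Normc.normc z | z in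
    [set z : R[i] |
      eigenvalue (map_mx (real_complex R) A) z]].

Definition M_matrix (R : realType) (n : nat) (B : 'M[R]_n) : Prop :=
  exists (s : R) (A : 'M[R]_n),
    [/\ forall i j, 0 <= A i j, spectral_radius A <= s & B = s%:M - A].

Definition reducible (R : realType) (n : nat) (B : 'M[R]_n) : Prop :=
  exists I : {set 'I_n},
    [/\ I != finset.set0, I \proper [set: 'I_n]%SET
      & forall i j, i \in I -> j \notin I -> B i j = 0].

Definition irreducible (R : realType) (n : nat) (B : 'M[R]_n) : Prop :=
  ~ reducible B.

Definition nonneg_sphere (R : realType) (n : nat) : set 'cV[R]_n :=
  [set x | enorm x = 1 /\ forall i, 0 <= x i 0].

Definition Proj (R : realType) (n : nat) (S : set 'cV[R]_n) (v : 'cV[R]_n) :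
    set 'cV[R]_n :=
  argmin (fun x => enorm (x - v)) S.

(* There is no x^0 in the algorithm: the value x 0 is left unconstrained. *)
Definition ADMM (R : realType) (n : nat) (f : 'cV[R]_n -> R) (rho : R)
    (y0 w0 : 'cV[R]_n) (x y w : nat -> 'cV[R]_n) : Prop :=
  [/\ y 0%N = y0, w 0%N = w0
    & forall k : nat,
      [/\ Proj (@nonneg_sphere R n) (y k - rho^-1 *: w k) (x k.+1),
          argmin (fun z => f z + dotv (w k) (x k.+1 - z)
                           + rho / 2 * enorm (x k.+1 - z) ^+ 2) setT (y k.+1)
        & w k.+1 = w k + rho *: (x k.+1 - y k.+1)]].

Definition quartic (R : realType) (n : nat) (alpha : R) (B : 'M[R]_n)
    (y : 'cV[R]_n) : R :=
  alpha / 2 * (\sum_(i < n) y i 0 ^+ 4) + (y^T *m B *m y) 0 0.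

(* Main.v *)
Require Import Defs.
From HB Require Import structures.
From mathcomp Require Import all_boot all_order all_algebra.
From mathcomp Require Import all_classical all_reals all_analysis.
From mathcomp Require Import complex ring lra.

Set Implicit Arguments.
Unset Strict Implicit.
Unset Printing Implicit Defensive.

Import Order.TTheory GRing.Theory Num.Theory.
Import numFieldNormedType.Exports.

Local Open Scope classical_set_scope.
Local Open Scope ring_scope.

(** The energy [f] is convex because a symmetric M-matrix has no negative
    eigenvalue, and on the unit sphere [f] has exactly one positive critical
    point, which is its global minimiser. Every cluster point of the
    iteration is that point, and compactness turns uniqueness of the cluster
    point into convergence of the whole sequence.

    Dynamics. The optimality condition of the [y]-step says that the multiplier
    is the gradient, [w k = grad f (y k)] for [k >= 1] ([dual_eq_grad]). Testing
    that condition against [y] keeps [y k] in the ball of radius [D]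
    ([primal_bounded]), where the gradient is [Lf]-Lipschitz. Hence the increase
    of the augmented Lagrangian in the [w]-step is smaller than its decrease in
    the [y]-step, by a fixed proportion of the squared step; as the augmented
    Lagrangian is bounded below, the steps vanish ([primal_step_cvg0]) and so
    does the distance between [x k.+2] and [y k.+1] ([projection_lag_cvg0]).

    Limits. A cluster point [p] of the [x k] is therefore a fixed point of the
    projected gradient step: [p] maximises the inner product with
    [v = p - grad f p / rho] over the nonnegative part of the sphere. That forces
    [p] to be proportional to the positive part of [v]; the sign pattern and the
    irreducibility of [B] exclude zero entries, and then
    [grad f p] is a multiple of [p] ([projected_gradient_fixpoint]).

    Uniqueness. For positive [p], writing [z i = p i * s i] shows that the form
    of [B] at [z] is at least [\sum_i (B *m p) i / p i * z i ^+ 2]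
    ([ground_state_inequality]). If [p] is critical, this makes [f z - f p] at
    least [alpha / 2 * \sum_i (z i ^+ 2 - p i ^+ 2) ^+ 2] on the sphere
    ([positive_critical_gap]). So [p] is a global minimiser, any two positive
    critical points coincide, and a sequence in a compact set with a single
    cluster point converges. *)

(** * Euclidean geometry of column vectors *)

Section InnerProduct.
Context {R : realType} {n : nat}.
Implicit Types (u v z : 'cV[R]_n) (a : R) (M : 'M[R]_n).

Lemma dotvE u v : dotv u v = \sum_i u i 0 * v i 0.
Proof. by rewrite /dotv mxE; apply: eq_bigr => i _; rewrite mxE. Qed.

Lemma dotvC u v : dotv u v = dotv v u.
Proof. by rewrite !dotvE; apply: eq_bigr => i _; rewrite mulrC. Qed.

Lemma dotvDl u v z : dotv (u + v) z = dotv u z + dotv v z.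
Proof. by rewrite /dotv linearD mulmxDl mxE. Qed.

Lemma dotvZl a u v : dotv (a *: u) v = a * dotv u v.
Proof. by rewrite /dotv linearZ -scalemxAl mxE. Qed.

Lemma dotvNl u v : dotv (- u) v = - dotv u v.
Proof. by rewrite -scaleN1r dotvZl mulN1r. Qed.

Lemma dotvDr u v z : dotv z (u + v) = dotv z u + dotv z v.
Proof. by rewrite !(dotvC z) dotvDl. Qed.

Lemma dotvZr a u v : dotv u (a *: v) = a * dotv u v.
Proof. by rewrite !(dotvC u) dotvZl. Qed.

Lemma dotvNr u v : dotv u (- v) = - dotv u v.
Proof. by rewrite !(dotvC u) dotvNl. Qed.

Lemma dotv0l u : dotv 0 u = 0.
Proof. by rewrite -(scale0r 0) dotvZl mul0r. Qed.

Definition dotv_lin := (dotvDl, dotvDr, dotvNl, dotvNr, dotvZl, dotvZr).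

Lemma dotv_ge0 u : 0 <= dotv u u.
Proof. by rewrite dotvE sumr_ge0// => i _; rewrite -expr2 sqr_ge0. Qed.

Lemma dotv_eq0 u : (dotv u u == 0) = (u == 0).
Proof.
apply/idP/eqP => [|->]; last by rewrite dotv0l.
rewrite dotvE psumr_eq0; last by move=> i _; rewrite -expr2 sqr_ge0.
move=> /allP u0; apply/matrixP => i j; rewrite ord1 mxE.
by have := u0 i (mem_index_enum _); rewrite mulf_eq0 orbb => /eqP.
Qed.

Lemma dotv_gt0 u : u != 0 -> 0 < dotv u u.
Proof. by move=> u0; rewrite lt0r dotv_eq0 u0 dotv_ge0. Qed.

Lemma enormE u : enorm u = Num.sqrt (dotv u u).
Proof. by rewrite dotvE; congr Num.sqrt; apply: eq_bigr. Qed.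

Lemma enorm_ge0 u : 0 <= enorm u.
Proof. exact: sqrtr_ge0. Qed.

Lemma enorm_sqr u : enorm u ^+ 2 = dotv u u.
Proof. by rewrite enormE sqr_sqrtr// dotv_ge0. Qed.

Lemma enorm_eq1 u : (enorm u = 1) <-> (dotv u u = 1).
Proof.
rewrite -enorm_sqr; split => [->|]; first by rewrite expr1n.
by move=> /eqP; rewrite sqrp_eq1 ?enorm_ge0// => /eqP.
Qed.

Lemma enorm_le u a : 0 <= a -> (enorm u <= a) = (dotv u u <= a ^+ 2).
Proof. by move=> a0; rewrite -enorm_sqr ler_sqr ?nnegrE ?enorm_ge0. Qed.

Lemma enormZ a u : enorm (a *: u) = `|a| * enorm u.
Proof.
by rewrite !enormE !dotv_lin mulrA -expr2 sqrtrM ?sqr_ge0// sqrtr_sqr.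
Qed.

Lemma enormN u : enorm (- u) = enorm u.
Proof. by rewrite !enormE !dotv_lin opprK. Qed.

(** The discriminant inequality for a binary quadratic form. The two-variable
    form avoids dividing by a leading coefficient that may vanish. *)
Lemma sqr_le_of_quadratic_ge0 (p q r : R) :
  0 <= p -> 0 <= r -> (forall t s, 0 <= t ^+ 2 * p + 2 * t * s * q + s ^+ 2 * r) ->
  q ^+ 2 <= p * r.
Proof.
move=> p0 r0 H; have [rp|] := ltP 0 r.
  have := H r (- q).
  have -> : r ^+ 2 * p + 2 * r * (- q) * q + (- q) ^+ 2 * r
          = r * (p * r - q ^+ 2) by ring.
  by rewrite pmulr_rge0// subr_ge0.
rewrite le_eqVlt ltNge r0 orbF => /eqP r00.
have := H (- q) (p + 1); rewrite r00 mulr0 addr0 mulr0.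
have -> : (- q) ^+ 2 * p + 2 * - q * (p + 1) * q = - (q ^+ 2 * (p + 2)) by ring.
by rewrite oppr_ge0 pmulr_lle0// ltr_wpDl.
Qed.

Lemma dotv_mulmx M u v : dotv u (M *m v) = dotv (M^T *m u) v.
Proof. by rewrite /dotv trmx_mul trmxK mulmxA. Qed.

(** Cauchy-Schwarz for the semi-inner product of a positive semidefinite
    matrix; the identity matrix gives the usual inequality. *)
Lemma psd_CauchySchwarz M u v : M^T = M -> (forall z, 0 <= dotv z (M *m z)) ->
  dotv u (M *m v) ^+ 2 <= dotv u (M *m u) * dotv v (M *m v).
Proof.
move=> symM M0; apply: sqr_le_of_quadratic_ge0 => // t s.
have := M0 (t *: u + s *: v).
rewrite mulmxDr -!scalemxAr !dotv_lin.
rewrite (_ : dotv v (M *m u) = dotv u (M *m v)).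
  by congr (0 <= _); ring.
by rewrite dotv_mulmx symM dotvC.
Qed.

Lemma CauchySchwarz u v : dotv u v ^+ 2 <= dotv u u * dotv v v.
Proof.
have := @psd_CauchySchwarz 1%:M u v (trmx1 _ _).
by rewrite !mul1mx; apply=> z; rewrite mul1mx dotv_ge0.
Qed.

Lemma dotv_le_enorm u v : dotv u v <= enorm u * enorm v.
Proof.
apply: le_trans (ler_norm _) _.
rewrite -ler_sqr ?nnegrE ?mulr_ge0 ?enorm_ge0//.
by rewrite real_normK ?num_real// exprMn !enorm_sqr CauchySchwarz.
Qed.

Lemma enormD u v : enorm (u + v) <= enorm u + enorm v.
Proof.
rewrite enorm_le ?addr_ge0 ?enorm_ge0// !dotv_lin (dotvC v u).
rewrite sqrrD -!enorm_sqr mulr2n.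
have := dotv_le_enorm u v; lra.
Qed.

Lemma coord_le_enorm u i : `|u i 0| <= enorm u.
Proof.
rewrite -ler_sqr ?nnegrE ?enorm_ge0// real_normK ?num_real// enorm_sqr dotvE.
by rewrite (bigD1 i)//= expr2 lerDl sumr_ge0// => j _; rewrite -expr2 sqr_ge0.
Qed.

End InnerProduct.

(** * Compactness of the sphere and extreme eigenvalues *)

Section Topology.
Context {R : realType} {n : nat}.
Implicit Types (u v : 'cV[R]_n) (M : 'M[R]_n).

Lemma trmx_continuous : continuous (@trmx R 1 n).
Proof.
move=> v A [P vP PA]; exists (fun i j => P j i).
  by move=> i j; have := vP j i; rewrite mxE.
by move=> u Pu; apply: PA => i j; rewrite mxE; exact: Pu.
Qed.

Lemma sum_continuous (F : 'I_n -> 'cV[R]_n -> R) :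
  (forall i, continuous (F i)) -> continuous (fun t => \sum_i F i t).
Proof.
move=> cF; apply: continuous_big => // p.
exact: add_continuous.
Qed.

(** Applied forms of the pointwise closure properties of continuity, which match
    the polynomial expressions in the coordinates syntactically. *)
Lemma fun_continuousM (f g : 'cV[R]_n -> R) :
  continuous f -> continuous g -> continuous (fun u => f u * g u).
Proof. by move=> cf cg u; apply: continuousM; [exact: cf|exact: cg]. Qed.

Lemma fun_continuousD (f g : 'cV[R]_n -> R) :
  continuous f -> continuous g -> continuous (fun u => f u + g u).
Proof. by move=> cf cg u; apply: (continuousD (cf u) (cg u)). Qed.

Lemma fun_continuousB (f g : 'cV[R]_n -> R) :
  continuous f -> continuous g -> continuous (fun u => f u - g u).
Proof. by move=> cf cg u; apply: (continuousB (cf u) (cg u)). Qed.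

Lemma fun_continuousX (f : 'cV[R]_n -> R) k :
  continuous f -> continuous (fun u => f u ^+ k).
Proof.
move=> cf u; apply: (@continuous_comp _ _ _ f (fun r => r ^+ k)); first exact: cf.
exact: exprn_continuous.
Qed.

Lemma mulmx_coord_continuous M i :
  continuous (fun u => (M *m u) i 0).
Proof.
under [X in continuous X]eq_fun do rewrite mxE.
apply: sum_continuous => j; apply: fun_continuousM; first exact: cst_continuous.
exact: coord_continuous.
Qed.

Lemma form_continuous M : continuous (fun u => dotv u (M *m u)).
Proof.
under [X in continuous X]eq_fun do rewrite dotvE.
apply: sum_continuous => j.
apply: fun_continuousM; first exact: coord_continuous.
exact: mulmx_coord_continuous.
Qed.

Lemma dotv_continuous : continuous (fun u => dotv u u).
Proof.
under [X in continuous X]eq_fun => u do rewrite -{2}(mul1mx u).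
exact: form_continuous.
Qed.

(** Heine-Borel for column vectors, transported by transposition from the
    product of segments in row vectors. *)
Lemma closed_bounded_compact (r : R) (A : set 'cV[R]_n) :
  closed A -> (forall u, A u -> enorm u <= r) -> compact A.
Proof.
move=> clA Ar.
pose box := [set v : 'rV[R]_n | forall i, v ord0 i \in `[- r, r]].
have cbox : compact box.
  apply: (@rV_compact _ _ (fun=> `[- r, r]%classic)) => _.
  exact: segment_compact.
have cbox' : compact (@trmx R 1 n @` box).
  apply: continuous_compact => //; apply: continuous_subspaceT.
  exact: trmx_continuous.
apply: subclosed_compact cbox' _ => // u Au; exists u^T; last by rewrite trmxK.
move=> i /=; rewrite in_itv/= -ler_norml mxE.
exact: le_trans (coord_le_enorm u i) (Ar _ Au).
Qed.

Lemma sphere_compact : compact [set u : 'cV[R]_n | dotv u u = 1].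
Proof.
apply: (@closed_bounded_compact 1) => [|u /= u1]; last first.
  by rewrite enorm_le// u1 expr1n.
apply: (@closed_comp _ _ (fun u => dotv u u) [set 1]) => //.
  by move=> u _; exact: dotv_continuous.
Qed.

(** The minimum of the quadratic form on the sphere is attained; the shifted
    form is then positive semidefinite and vanishes at the minimiser, which
    Cauchy-Schwarz turns into the eigenvalue equation. *)
Lemma symmetric_min_eigenpair M : (0 < n)%N -> M^T = M ->
  exists (a : R) (v : 'cV[R]_n),
    [/\ v != 0, M *m v = a *: v & forall u, a * dotv u u <= dotv u (M *m u)].
Proof.
move=> n0 symM.
have [|||v /set_mem v1 minv] := @compact_EVT_min 'cV[R]_n R
    (fun u => dotv u (M *m u)) [set u | dotv u u = 1].
- exists (delta_mx (Ordinal n0) 0) => /=.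
  rewrite dotvE (bigD1 (Ordinal n0))//= mxE !eqxx mulr1 big1 ?addr0// => i.
  by move=> /negbTE ni; rewrite mxE ni mul0r.
- exact: sphere_compact.
- apply: continuous_subspaceT; exact: form_continuous.
pose a := dotv v (M *m v).
have aP u : a * dotv u u <= dotv u (M *m u).
  have [->|u0] := eqVneq u 0; first by rewrite !dotv0l mulr0.
  have eu0 : enorm u != 0.
    by apply: contra_neq u0 => eu; apply/eqP; rewrite -dotv_eq0 -enorm_sqr eu expr0n.
  have := minv ((enorm u)^-1 *: u); rewrite inE/=.
  rewrite -scalemxAr !dotv_lin -enorm_sqr -/a => /(_ _).
  set e := enorm u in eu0 *; set q := dotv u (M *m u) => H.
  have : a <= e^-1 * (e^-1 * q) by apply: H; field.
  have e2 : 0 < e ^+ 2 by rewrite exprn_even_gt0.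
  by rewrite mulrA -invfM -expr2 ler_pdivlMl// mulrC.
exists a, v; split=> //.
  by apply: contra_eq_neq v1 => ->; rewrite dotv0l eq_sym oner_eq0.
(* The Cauchy-Schwarz inequality between [z = Ma *m v] and [v]: the form of
   [Ma] vanishes at [v], hence so does [dotv z (Ma *m v) = dotv z z]. *)
pose Ma := M - a%:M.
have MaE u : Ma *m u = M *m u - a *: u by rewrite mulmxBl mul_scalar_mx.
apply/eqP; rewrite -subr_eq0 -MaE -dotv_eq0.
set z := Ma *m v.
have := @psd_CauchySchwarz _ _ Ma z v _ _.
rewrite {2}MaE !dotv_lin v1 mulr1 subrr mulr0 => H.
have {H} : dotv z z ^+ 2 <= 0.
  apply: H => [|u]; first by rewrite linearB/= tr_scalar_mx symM.
  by rewrite MaE !dotv_lin subr_ge0.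
by move=> H; rewrite -sqrf_eq0 eq_le H sqr_ge0.
Qed.

Lemma eigenvalue_sym_col M a : M^T = M ->
  eigenvalue M a <-> exists2 v : 'cV[R]_n, v != 0 & M *m v = a *: v.
Proof.
move=> symM; split=> [/eigenvalueP[v vM v0]|[v v0 Mv]].
  exists v^T; last by rewrite -{1}symM -trmx_mul vM linearZ.
  by apply: contra_neq v0 => vT0; rewrite -(trmxK v) vT0 trmx0.
apply/eigenvalueP; exists v^T.
  by rewrite -{1}symM -trmx_mul Mv linearZ.
by apply: contra_neq v0 => vT0; rewrite -(trmxK v) vT0 trmx0.
Qed.

(** The infimum in [lambda_min] is attained: it is the eigenvalue found by
    minimising the form, which gives the Rayleigh bound as well. *)
Lemma lambda_min_eigenvalue M : (0 < n)%N -> M^T = M ->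
  eigenvalue M (lambda_min M) /\
  forall u, lambda_min M * dotv u u <= dotv u (M *m u).
Proof.
move=> n0 symM; have [a [v [v0 Mv aP]]] := symmetric_min_eigenpair n0 symM.
have eva : eigenvalue M a by apply/eigenvalue_sym_col => //; exists v.
have lba b : eigenvalue M b -> a <= b.
  move=> /eigenvalue_sym_col[]// u u0 Mu.
  by have := aP u; rewrite Mu dotvZr ler_pM2r// dotv_gt0.
suff -> : lambda_min M = a by [].
apply/eqP; rewrite eq_le; apply/andP; split.
  by apply: ge_inf => //; exists a => b; exact: lba.
by apply: lb_le_inf; [exists a | move=> b; exact: lba].
Qed.

Lemma lambda_max_form M u : (0 < n)%N -> M^T = M ->
  dotv u (M *m u) <= lambda_max M * dotv u u.
Proof.
move=> n0 symM.
have symNM : (- M)^T = - M by rewrite linearN/= symM.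
have [_ /(_ u)] := lambda_min_eigenvalue n0 symNM.
suff -> : lambda_min (- M) = - lambda_max M.
  by rewrite mulNmx dotvNr mulNr lerN2.
congr (- sup _); apply/seteqP; split=> [_ [a /= Ma <-]|a /= Ma].
  move: Ma => /eigenvalueP[v vM v0]; apply/eigenvalueP; exists v => //.
  by rewrite scaleNr -vM mulmxN opprK.
exists (- a); rewrite ?opprK//=.
move: Ma => /eigenvalueP[v vM v0]; apply/eigenvalueP; exists v => //.
by rewrite mulmxN vM scaleNr.
Qed.

End Topology.

(** * Spectral consequences of the M-matrix property *)

Section MMatrix.
Context {R : realType} {n : nat}.
Implicit Types (u v : 'cV[R]_n) (A M B : 'M[R]_n).

(** The supremum defining the spectral radius is a genuine upper bound because
    the complex eigenvalues are the finitely many roots of the characteristic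
    polynomial. *)
Lemma eigenvalue_le_spectral_radius A (a : R) :
  eigenvalue A a -> a <= spectral_radius A.
Proof.
move=> evAa; pose AC := map_mx (real_complex R) A.
have evAC : eigenvalue AC (real_complex R a).
  have /eigenvalueP[v vA v0] := evAa; apply/eigenvalueP.
  exists (map_mx (real_complex R) v); first by rewrite -map_mxM vA map_mxZ.
  by rewrite map_mx_eq0.
apply: (@le_trans _ _ (ComplexField.Normc.normc (real_complex R a))).
  by rewrite /= expr0n/= addr0 sqrtr_sqr ler_norm.
apply: ub_le_sup; last by exists (real_complex R a).
have [rs defp] := closed_field_poly_normal (char_poly AC).
exists (\sum_(r <- rs) ComplexField.Normc.normc r) => _ [z /= evz <-].
have norm_ge0 (r : R[i]) : 0 <= ComplexField.Normc.normc r.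
  by case: r => p q; exact: sqrtr_ge0.
have : z \in rs.
  rewrite -root_prod_XsubC; move: evz; rewrite eigenvalue_root_char defp.
  by rewrite (monicP (char_poly_monic _)) scale1r.
by move=> zrs; rewrite (big_rem z)//= lerDl sumr_ge0.
Qed.

Lemma M_matrix_offdiag B i j : M_matrix B -> i != j -> B i j <= 0.
Proof.
move=> [s [A [A0 _ ->]]] /negbTE ij.
by rewrite !mxE ij mulr0n sub0r oppr_le0.
Qed.

(** An eigenvalue [b] of [B = s%:M - A] is [s - a] for an eigenvalue [a] of [A],
    and [a] is at most the spectral radius, hence at most [s]. *)
Lemma M_matrix_lambda_min_ge0 B : (0 < n)%N -> B^T = B -> M_matrix B ->
  0 <= lambda_min B.
Proof.
move=> n0 symB [s [A [_ As defB]]].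
have [/eigenvalueP[v vB v0] _] := lambda_min_eigenvalue n0 symB.
have evA : eigenvalue A (s - lambda_min B).
  apply/eigenvalueP; exists v => //.
  have -> : A = s%:M - B by rewrite defB opprB addrCA subrr addr0.
  by rewrite mulmxBr mul_mx_scalar vB scalerBl.
by have := le_trans (eigenvalue_le_spectral_radius evA) As; rewrite gerBl.
Qed.

Lemma lambda_max_ge0 M : (0 < n)%N -> M^T = M ->
  (forall u, 0 <= dotv u (M *m u)) -> 0 <= lambda_max M.
Proof.
move=> n0 symM psd; pose e : 'cV[R]_n := delta_mx (Ordinal n0) 0.
have e0 : e != 0.
  apply/eqP => /matrixP/(_ (Ordinal n0) 0); rewrite !mxE !eqxx => /eqP.
  by rewrite oner_eq0.
have := le_trans (psd e) (lambda_max_form e n0 symM).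
by rewrite pmulr_lge0// dotv_gt0.
Qed.

(** Cauchy-Schwarz for the form of [M], applied to [M *m u] and [u], bounds
    the operator norm by the largest eigenvalue without diagonalising. *)
Lemma enorm_mulmx_le M u : (0 < n)%N -> M^T = M ->
  (forall u, 0 <= dotv u (M *m u)) -> enorm (M *m u) <= lambda_max M * enorm u.
Proof.
move=> n0 symM psd; have l0 := lambda_max_ge0 n0 symM psd.
rewrite enorm_le ?mulr_ge0 ?enorm_ge0// exprMn enorm_sqr.
set z := M *m u; have [->|z0] := eqVneq z 0.
  by rewrite dotv0l mulr_ge0 ?sqr_ge0 ?dotv_ge0.
have := psd_CauchySchwarz z u symM psd; rewrite -/z => H.
have {H} : dotv z z ^+ 2 <= (lambda_max M * dotv z z) * (lambda_max M * dotv u u).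
  by apply: le_trans H _; apply: ler_pM => //; exact: lambda_max_form.
rewrite (_ : _ * _ * _ = lambda_max M ^+ 2 * dotv u u * dotv z z); last by ring.
by rewrite expr2 ler_pM2r// dotv_gt0.
Qed.

End MMatrix.

(** * The quartic energy: gradient, convexity, growth *)

Section Quartic.
Context {R : realType} {n : nat}.
Variables (alpha : R) (B : 'M[R]_n).
Hypothesis symB : B^T = B.
Implicit Types (u v y d z : 'cV[R]_n).

Local Notation f := (quartic alpha B).

Definition quartic_grad y : 'cV[R]_n :=
  \col_i (2 * alpha * y i 0 ^+ 3 + 2 * (B *m y) i 0).

(** The part of [f (y + d)] of order at least two in [d]. *)
Definition quartic_rem y d : R :=
  alpha / 2 * (\sum_i d i 0 ^+ 2 * (6 * y i 0 ^+ 2 + 4 * y i 0 * d i 0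
                                    + d i 0 ^+ 2))
  + dotv d (B *m d).

Lemma quarticE y : f y = alpha / 2 * (\sum_i y i 0 ^+ 4) + dotv y (B *m y).
Proof. by rewrite /quartic /dotv mulmxA. Qed.

Lemma dotv_quartic_grad y d :
  dotv (quartic_grad y) d
  = 2 * alpha * (\sum_i y i 0 ^+ 3 * d i 0) + 2 * dotv (B *m y) d.
Proof.
rewrite !dotvE !mulr_sumr -big_split/=; apply: eq_bigr => i _.
by rewrite mxE; ring.
Qed.

Lemma quartic_expand y d :
  f (y + d) = f y + dotv (quartic_grad y) d + quartic_rem y d.
Proof.
rewrite dotv_quartic_grad !quarticE /quartic_rem mulmxDr !dotv_lin.
rewrite (_ : dotv y (B *m d) = dotv d (B *m y)); last first.
  by rewrite dotv_mulmx symB dotvC.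
rewrite (dotvC (B *m y)).
rewrite (_ : \sum_i (y + d) i 0 ^+ 4 = \sum_i y i 0 ^+ 4
   + 4 * (\sum_i y i 0 ^+ 3 * d i 0)
   + (\sum_i d i 0 ^+ 2 * (6 * y i 0 ^+ 2 + 4 * y i 0 * d i 0
                                    + d i 0 ^+ 2))); first by field.
rewrite mulr_sumr -!big_split/=; apply: eq_bigr => i _.
by rewrite mxE; ring.
Qed.

(** Along a line the remainder is [t ^+ 2] times a polynomial in [t]. This both
    computes directional derivatives and makes first-order optimality
    conditions an algebraic statement. *)
Lemma quartic_remZ y d : exists b c e : R, forall t,
  quartic_rem y (t *: d) = t ^+ 2 * (b + t * c + t ^+ 2 * e).
Proof.
exists (alpha / 2 * (\sum_i 6 * y i 0 ^+ 2 * d i 0 ^+ 2) + dotv d (B *m d)).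
exists (alpha / 2 * (\sum_i 4 * y i 0 * d i 0 ^+ 3)).
exists (alpha / 2 * (\sum_i d i 0 ^+ 4)) => t.
rewrite /quartic_rem -scalemxAr !dotv_lin.
rewrite (_ : \sum_i _ = t ^+ 2 * ((\sum_i 6 * y i 0 ^+ 2 * d i 0 ^+ 2)
   + t * (\sum_i 4 * y i 0 * d i 0 ^+ 3) + t ^+ 2 * (\sum_i d i 0 ^+ 4))).
  by field.
rewrite !mulr_sumr -!big_split/= mulr_sumr; apply: eq_bigr => i _.
by rewrite mxE; ring.
Qed.

(** Convexity: the quartic part is a sum of squares,
    [6 y^2 + 4 y d + d^2 = 2 y^2 + (2 y + d)^2]. *)
Lemma quartic_rem_ge0 y d : 0 <= alpha -> (forall u, 0 <= dotv u (B *m u)) ->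
  0 <= quartic_rem y d.
Proof.
move=> a0 psdB; rewrite addr_ge0// mulr_ge0 ?divr_ge0// sumr_ge0// => i _.
rewrite mulr_ge0 ?sqr_ge0//.
rewrite (_ : _ + _ = 2 * y i 0 ^+ 2 + (2 * y i 0 + d i 0) ^+ 2); last by ring.
by rewrite addr_ge0 ?sqr_ge0// mulr_ge0 ?sqr_ge0.
Qed.

Lemma derive_quartic y d : 'D_d f y = dotv (quartic_grad y) d.
Proof.
have [b [c [e remE]]] := quartic_remZ y d.
apply: cvg_lim => //.
pose q (h : R) := dotv (quartic_grad y) d + h * (b + h * c + h ^+ 2 * e).
have cq : q h @[h --> (0 : R)^'] --> dotv (quartic_grad y) d.
  have -> : dotv (quartic_grad y) d = q 0 by rewrite /q mul0r addr0.
  apply: cvg_within_filter.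
  have cid : continuous (fun h : R => h) by move=> h; exact: cvg_id.
  have csq : continuous (fun h : R => h ^+ 2) by exact: exprn_continuous.
  apply: cvgD; first exact: cvg_cst.
  apply: cvgM; first exact: cid.
  apply: cvgD; [apply: cvgD; [exact: cvg_cst|] |].
  - by apply: cvgM; [exact: cid|exact: cvg_cst].
  - by apply: cvgM; [exact: csq|exact: cvg_cst].
apply: cvg_trans cq; apply: near_eq_cvg; near=> h.
have h0 : h != 0 by near: h; exact: nbhs_dnbhs_neq.
rewrite /= (addrC (h *: d)) quartic_expand remE dotvZr /q /GRing.scale/=.
by field.
Unshelve. all: by end_near. Qed.

Lemma grad_quartic y : grad f y = quartic_grad y.
Proof.
apply/matrixP => i j; rewrite ord1 mxE derive_quartic dotvE (bigD1 i)//=.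
rewrite [X in _ + X]big1 => [|k /negbTE ki].
  by rewrite [delta_mx _ _ _ _]mxE !eqxx mulr1 addr0.
by rewrite [delta_mx _ _ _ _]mxE ki mulr0.
Qed.

(** First-order optimality without derivatives: a polynomial of degree four
    vanishing at its minimum [0] has no linear term. The test point is [- s * a],
    with [s] so small that the linear term dominates. *)
Lemma linear_part_eq0 (a b c e : R) :
  (forall t, 0 <= t * a + t ^+ 2 * (b + t * c + t ^+ 2 * e)) -> a = 0.
Proof.
move=> H; apply/eqP; rewrite -[_ == _]negbK; apply/negP => a0.
have a_gt0 : 0 < `|a| by rewrite normr_gt0.
pose K := `|b| + `|c| + `|e|; pose s := (K + `|a|)^-1.
have K0 : 0 <= K by rewrite !addr_ge0.
have Ka : 0 < K + `|a| by rewrite ltr_wpDl.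
have s0 : 0 < s by rewrite invr_gt0.
have t1 : `|s * a| <= 1.
  by rewrite normrM gtr0_norm// ler_pdivrMl// mulr1 lerDr.
have := H (- (s * a)); set t := s * a in t1 *.
have : b + - t * c + (- t) ^+ 2 * e <= K.
  rewrite mulNr sqrrN /K; apply: lerD; last first.
    apply: le_trans (ler_norm _) _; rewrite normrM ler_piMl// normrX.
    by rewrite expr_le1.
  apply: lerD; first exact: ler_norm.
  by apply: le_trans (ler_norm _) _; rewrite normrN normrM ler_piMl.
move=> /(ler_wpM2l (sqr_ge0 (- t)))/(lerD (lexx (- t * a))) => H1 H2.
have := le_trans H2 H1.
rewrite (_ : _ + _ = - (s * a ^+ 2) * (1 - s * K)); last by rewrite /t; ring.
have sK : s * (K + `|a|) = 1 by rewrite mulVf// gt_eqF.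
rewrite (_ : 1 - s * K = s * `|a|); last by rewrite -sK; ring.
rewrite mulNr oppr_ge0 leNgt => /negP; apply.
have a2 : 0 < a ^+ 2 by rewrite exprn_even_gt0.
exact: mulr_gt0 (mulr_gt0 s0 a2) (mulr_gt0 s0 a_gt0).
Qed.

Lemma quartic_ge0 y : 0 <= alpha -> (forall u, 0 <= dotv u (B *m u)) ->
  0 <= f y.
Proof.
move=> a0 psdB; rewrite quarticE addr_ge0// mulr_ge0 ?divr_ge0// sumr_ge0//.
by move=> i _; rewrite exprn_even_ge0.
Qed.

Lemma sqr_coord_le y i : y i 0 ^+ 2 <= dotv y y.
Proof.
by rewrite -enorm_sqr -(real_normK (num_real (y i 0))) ler_sqr ?nnegrE
  ?enorm_ge0// coord_le_enorm.
Qed.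

(** The entrywise cube has norm at most the cube of the norm, since every
    squared entry is at most the squared norm. *)
Lemma enorm_quartic_grad_le y : (0 < n)%N -> 0 <= alpha ->
  (forall u, 0 <= dotv u (B *m u)) ->
  enorm (quartic_grad y) <= 2 * alpha * enorm y ^+ 3
                            + 2 * lambda_max B * enorm y.
Proof.
move=> n0 a0 psdB.
have -> : quartic_grad y
    = (2 * alpha) *: (\col_i y i 0 ^+ 3) + 2 *: (B *m y).
  by apply/matrixP => i j; rewrite ord1 !mxE.
apply: le_trans (enormD _ _) _; rewrite !enormZ !ger0_norm ?mulr_ge0//.
apply: lerD; last by rewrite -mulrA ler_wpM2l// enorm_mulmx_le.
rewrite ler_wpM2l ?mulr_ge0// enorm_le ?exprn_ge0 ?enorm_ge0//.
rewrite -exprM mulnC exprM enorm_sqr dotvE.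
apply: (@le_trans _ _ (\sum_i dotv y y ^+ 2 * y i 0 ^+ 2)); last first.
  rewrite -mulr_sumr [leRHS]exprSr ler_wpM2l ?sqr_ge0// dotvE.
  by apply: ler_sum => i _.
apply: ler_sum => i _; rewrite !mxE.
rewrite (_ : _ * _ = (y i 0 ^+ 2) ^+ 2 * y i 0 ^+ 2); last by ring.
by rewrite ler_wpM2r ?sqr_ge0// ler_sqr ?nnegrE ?sqr_ge0 ?dotv_ge0// sqr_coord_le.
Qed.

End Quartic.

(** * The positive critical point on the sphere *)

Section GroundState.
Context {R : realType} {n : nat}.
Variables (alpha : R) (B : 'M[R]_n).
Hypotheses (alpha_gt0 : 0 < alpha) (symB : B^T = B).
Hypothesis offB : forall i j, i != j -> B i j <= 0.
Implicit Types (u v p q z : 'cV[R]_n).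

Local Notation f := (quartic alpha B).
Local Notation G := (quartic_grad alpha B).

(** Substituting [z = p * s] entrywise turns the form into a diagonal part plus
    a sum of squared differences of [s], with nonnegative weights
    [- B i j * p i * p j]. *)
Lemma ground_state_inequality p z : (forall i, 0 < p i 0) ->
  \sum_i (B *m p) i 0 / p i 0 * z i 0 ^+ 2 <= dotv z (B *m z).
Proof.
move=> p0; rewrite -subr_ge0.
pose r i j := B i j * (z i 0 * z j 0 - p j 0 / p i 0 * z i 0 ^+ 2).
have -> : dotv z (B *m z) - \sum_i (B *m p) i 0 / p i 0 * z i 0 ^+ 2
        = \sum_i \sum_j r i j.
  rewrite dotvE -sumrB; apply: eq_bigr => i _; rewrite !mxE mulr_sumr !mulr_suml.
  by rewrite -sumrB; apply: eq_bigr => j _; rewrite /r; ring.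
have : 0 <= \sum_i \sum_j (r i j + r j i).
  apply: sumr_ge0 => i _; apply: sumr_ge0 => j _.
  have Bji : B j i = B i j by rewrite -{1}symB mxE.
  have pi0 : p i 0 != 0 by rewrite gt_eqF.
  have pj0 : p j 0 != 0 by rewrite gt_eqF.
  (* The diagonal terms vanish, so only the nonpositive entries contribute. *)
  have -> : r i j + r j i
      = - B i j * (p i 0 * p j 0) * (z i 0 / p i 0 - z j 0 / p j 0) ^+ 2.
    by rewrite /r Bji; field; rewrite pi0 pj0.
  have [->|ij] := eqVneq i j; first by rewrite subrr expr0n mulr0.
  rewrite mulr_ge0 ?sqr_ge0// mulr_ge0 ?oppr_ge0 ?offB//.
  by rewrite ltW// mulr_gt0.
under eq_bigr do rewrite big_split/=.
by rewrite big_split/= [X in _ + X]exchange_big/= -mulr2n pmulrn_lge0.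
Qed.

(** A positive critical point of the energy on the sphere minimises it
    globally: the ground state inequality replaces the quadratic part by a
    diagonal one, and what remains is a sum of squares of polynomials in the [z i ^+ 2]. *)
Lemma positive_critical_gap p z (mu : R) : (forall i, 0 < p i 0) ->
  G p = mu *: p -> dotv p p = 1 -> dotv z z = 1 ->
  f p + alpha / 2 * (\sum_i (z i 0 ^+ 2 - p i 0 ^+ 2) ^+ 2) <= f z.
Proof.
move=> p0 Gp p1 z1.
have Bp i : (B *m p) i 0 = (mu / 2 - alpha * p i 0 ^+ 2) * p i 0.
  move/matrixP/(_ i 0) : Gp; rewrite !mxE => Gpi.
  apply: (@mulfI _ 2); first by rewrite pnatr_eq0.
  by rewrite -[LHS](addKr (2 * alpha * p i 0 ^+ 3)) Gpi; field.
have := ground_state_inequality z p0.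
under eq_bigr => i _ do rewrite Bp mulfK ?gt_eqF//.
move=> H; rewrite !quarticE.
have -> : dotv p (B *m p) = \sum_i (mu / 2 - alpha * p i 0 ^+ 2) * p i 0 ^+ 2.
  by rewrite dotvE; apply: eq_bigr => i _; rewrite Bp; ring.
apply: le_trans (lerD (lexx _) H).
rewrite !mulr_sumr -!big_split/= -subr_ge0 -sumrB.
rewrite (eq_bigr (fun i => mu / 2 * (z i 0 * z i 0 - p i 0 * p i 0))).
  by rewrite -mulr_sumr sumrB -!dotvE z1 p1 subrr mulr0.
by move=> i _; field.
Qed.

(** Each of the two critical points minimises the energy, so both gaps are
    zero; nonnegative numbers with equal squares are equal. *)
Lemma positive_critical_unique p q (mu nu : R) :
  (forall i, 0 < p i 0) -> (forall i, 0 < q i 0) ->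
  G p = mu *: p -> G q = nu *: q -> dotv p p = 1 -> dotv q q = 1 -> p = q.
Proof.
move=> p0 q0 Gp Gq p1 q1.
have pq := positive_critical_gap p0 Gp p1 q1.
have qp := positive_critical_gap q0 Gq q1 p1.
have sq0 : \sum_i (q i 0 ^+ 2 - p i 0 ^+ 2) ^+ 2 = 0.
  apply/eqP; rewrite eq_le sumr_ge0 ?andbT; last by move=> i _; exact: sqr_ge0.
  have : 0 <= alpha / 2 * (\sum_i (p i 0 ^+ 2 - q i 0 ^+ 2) ^+ 2).
    rewrite mulr_ge0 ?divr_ge0 ?(ltW alpha_gt0)//.
    by rewrite sumr_ge0// => i _; exact: sqr_ge0.
  move=> H; have : alpha / 2 * (\sum_i (q i 0 ^+ 2 - p i 0 ^+ 2) ^+ 2) <= 0.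
    by lra.
  by rewrite pmulr_rle0// divr_gt0.
apply/matrixP => i j; rewrite ord1.
move/eqP: sq0; rewrite psumr_eq0; last by move=> k _; exact: sqr_ge0.
move=> /allP/(_ i (mem_index_enum _)); rewrite sqrf_eq0 subr_eq0.
by rewrite eqrXn2 ?ltW// => /eqP.
Qed.

Variable rho : R.
Hypothesis irrB : irreducible B.
Hypothesis rho_gt : 2 * alpha + 2 * lambda_max B < rho.
Hypothesis rho_gt0 : 0 < rho.

(** A fixed point of the projected gradient step with step size [rho^-1] is the
    normalised positive part of the point [v] that is projected: [p] and the
    positive part of [v] realise equality in Cauchy-Schwarz. The lower bound on
    [rho] makes [dotv p v] positive. At a zero of [p] the positive part vanishes
    as well, which, by the sign pattern of [B], decouples the zeros of [p] from
    its support; irreducibility rules that out. *)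
Lemma projected_gradient_fixpoint p : (0 < n)%N ->
  dotv p p = 1 -> (forall i, 0 <= p i 0) ->
  (forall z, nonneg_sphere z ->
     dotv z (p - rho^-1 *: G p) <= dotv p (p - rho^-1 *: G p)) ->
  (forall i, 0 < p i 0) /\ exists mu, G p = mu *: p.
Proof.
move=> n0 p1 p_ge0; set v := p - _ => vmax.
pose c := dotv p v; pose vp : 'cV[R]_n := \col_i Num.max 0 (v i 0).
have vp_ge0 i : 0 <= vp i 0 by rewrite mxE le_max lexx.
have c_gt0 : 0 < c.
  rewrite /c /v !dotv_lin p1 subr_gt0 mulrC ltr_pdivrMr// mul1r dotvC.
  rewrite dotv_quartic_grad (dotvC (B *m p)).
  have := lambda_max_form p n0 symB; rewrite p1 mulr1 => Bp.
  set S := \sum_i _; have : alpha * S <= alpha * 1.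
    rewrite ler_pM2l// -p1 dotvE; apply: ler_sum => i _.
    rewrite exprSr -mulrA -expr2 ler_piMl ?sqr_ge0//.
    by rewrite -p1 sqr_coord_le.
  move: Bp (rho_gt); rewrite -mulrA.
  move: (alpha * S) (dotv p _) (lambda_max B) => aS pBp l.
  lra.
have cvp : c <= dotv p vp.
  rewrite /c !dotvE; apply: ler_sum => i _; rewrite ler_wpM2l// [leRHS]mxE.
  by rewrite le_max lexx orbT.
have vpv : dotv vp v = dotv vp vp.
  rewrite !dotvE; apply: eq_bigr => i _; rewrite [vp i 0]mxE.
  by have [_|_] := leP (v i 0) 0; rewrite ?mul0r.
have evp : 0 < enorm vp.
  rewrite lt0r enorm_ge0 andbT; apply: contraTneq c_gt0 => evp0.
  have vp0 : vp = 0 by apply/eqP; rewrite -dotv_eq0 -enorm_sqr evp0 expr0n.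
  by move: cvp; rewrite vp0 dotvC dotv0l leNgt.
have vpc : enorm vp <= c.
  have /vmax : nonneg_sphere ((enorm vp)^-1 *: vp).
    split; last by move=> i; rewrite mxE mulr_ge0 ?invr_ge0 ?enorm_ge0.
    by rewrite enormZ ger0_norm ?invr_ge0 ?enorm_ge0// mulVf// gt_eqF.
  by rewrite dotvZl vpv -enorm_sqr expr2 mulKf// gt_eqF.
(* Expand the squared norm of the difference, with [dotv p p = 1],
   [enorm vp <= c] and [c <= dotv p vp]. *)
have vpE : vp = c *: p.
  apply/eqP; rewrite -subr_eq0 -dotv_eq0 eq_le dotv_ge0 andbT.
  rewrite !dotv_lin p1 (dotvC vp p) -enorm_sqr.
  have : enorm vp ^+ 2 <= c ^+ 2 by rewrite ler_sqr ?nnegrE ?enorm_ge0// ltW.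
  have : c * c <= c * dotv p vp by rewrite ler_pM2l.
  lra.
have p_gt0 i : 0 < p i 0.
  rewrite lt0r p_ge0 andbT; apply/negP => pi0; apply: irrB.
  exists [set k | p k 0 == 0]%SET; split.
  - by apply/set0Pn; exists i; rewrite !inE.
  - rewrite properT; apply/eqP => allp0.
    move/eqP: p1; rewrite dotvE big1 ?(eq_sym 0) ?oner_eq0// => k _.
    have : k \in [set k | p k 0 == 0]%SET by rewrite allp0 !inE.
    by rewrite !inE => /eqP ->; rewrite mul0r.
  - move=> k j; rewrite !inE => /eqP pk0 pj0.
    have vk : v k 0 <= 0.
      have := vpE => /matrixP/(_ k 0).
      rewrite [vp k 0]mxE [RHS]mxE pk0 mulr0 => <-.
      by rewrite le_max lexx orbT.
    have terms_le0 l : B k l * p l 0 <= 0.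
      have [<-|kl] := eqVneq k l; first by rewrite pk0 mulr0.
      by rewrite mulr_le0_ge0 ?offB.
    have Bp0 : (B *m p) k 0 = 0.
      apply/eqP; rewrite eq_le; apply/andP; split.
        by rewrite mxE sumr_le0.
      move: vk; rewrite !mxE pk0 expr0n/= mulr0 !add0r oppr_le0.
      by rewrite pmulr_rge0 ?invr_gt0// pmulr_rge0.
    move/eqP: Bp0; rewrite mxE -oppr_eq0 -sumrN psumr_eq0; last first.
      by move=> l _; rewrite oppr_ge0.
    move=> /allP/(_ j (mem_index_enum _)).
    by rewrite oppr_eq0 mulf_eq0 (negbTE pj0) orbF => /eqP.
split=> //; exists (rho * (1 - c)).
have vE : v = c *: p.
  rewrite -vpE; apply/matrixP => i j; rewrite ord1 [RHS]mxE.
  move/matrixP/(_ i 0) : vpE; rewrite [vp i 0]mxE [RHS]mxE.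
  have := mulr_gt0 c_gt0 (p_gt0 i); case: (leP (v i 0) 0) => // _ + cp0.
  by rewrite -cp0 ltxx.
rewrite -scalerA scalerBl scale1r -vE /v opprB addrCA subrr addr0.
by rewrite scalerA mulfV ?scale1r// gt_eqF.
Qed.

End GroundState.

(** * Descent of the augmented Lagrangian *)

Section AugmentedLagrangian.
Context {R : realType} {n : nat}.
Variables (alpha : R) (B : 'M[R]_n) (rho : R).
Hypotheses (symB : B^T = B) (rho_gt0 : 0 < rho).
Implicit Types (u v x y d w z : 'cV[R]_n).

Local Notation f := (quartic alpha B).
Local Notation G := (quartic_grad alpha B).

Definition aug_lagrangian x y w : R :=
  f y + dotv w (x - y) + rho / 2 * enorm (x - y) ^+ 2.

(** Completing the square in [x]: up to terms that do not involve [x], the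
    augmented Lagrangian is the squared distance that the projection minimises.
    The same form shows that it is bounded below when [w] is bounded. *)
Lemma aug_lagrangian_square x y w :
  aug_lagrangian x y w = f y
    + rho / 2 * enorm (x - (y - rho^-1 *: w)) ^+ 2 - (2 * rho)^-1 * dotv w w.
Proof.
rewrite /aug_lagrangian opprB addrCA !enorm_sqr.
move: (x - y) => u.
rewrite !dotv_lin (dotvC w u).
by field; rewrite gt_eqF.
Qed.

Lemma aug_lagrangian_lb x y w : 0 <= alpha ->
  (forall u, 0 <= dotv u (B *m u)) ->
  - ((2 * rho)^-1 * dotv w w) <= aug_lagrangian x y w.
Proof.
move=> a0 psdB; rewrite aug_lagrangian_square lerDr addr_ge0 ?quartic_ge0//.
by rewrite mulr_ge0 ?sqr_ge0 ?divr_ge0 ?(ltW rho_gt0).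
Qed.

Lemma aug_lagrangian_expand x y w d :
  aug_lagrangian x (y + d) w = aug_lagrangian x y w
    + dotv (G y - (w + rho *: (x - y))) d
    + (quartic_rem alpha B y d + rho / 2 * dotv d d).
Proof.
rewrite /aug_lagrangian quartic_expand// !enorm_sqr (opprD y d) (addrA x).
move: (x - y) => u; rewrite !dotv_lin (dotvC d u).
by field.
Qed.

Lemma y_step_grad x w y : argmin (aug_lagrangian x ^~ w) setT y ->
  G y = w + rho *: (x - y).
Proof.
move=> [_ miny]; set u := _ + _; pose r := G y - u.
apply/eqP; rewrite -subr_eq0 -/r -dotv_eq0.
have [b [c [e remE]]] := quartic_remZ alpha B y r.
apply/eqP/(@linear_part_eq0 _ _ (b + rho / 2 * dotv r r) c e) => t.
have := miny (y + t *: r) I; rewrite aug_lagrangian_expand -/u -/r.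
rewrite -addrA lerDl remE !dotv_lin.
by congr (0 <= _); field.
Qed.

(** With a vanishing first-order term, the expansion at the minimiser [y] leaves
    the penalty [rho / 2] times the squared step and a nonnegative remainder. *)
Lemma y_step_descent x w y y' : 0 <= alpha ->
  (forall u, 0 <= dotv u (B *m u)) ->
  argmin (aug_lagrangian x ^~ w) setT y ->
  aug_lagrangian x y w + rho / 2 * enorm (y - y') ^+ 2 <= aug_lagrangian x y' w.
Proof.
move=> a0 psdB /y_step_grad Gy.
have -> : aug_lagrangian x y' w = aug_lagrangian x (y + (y' - y)) w.
  by rewrite addrCA subrr addr0.
rewrite aug_lagrangian_expand Gy subrr dotv0l addr0 lerD2l.
rewrite -(opprB y' y) enormN enorm_sqr lerDr.
exact: quartic_rem_ge0.
Qed.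

Lemma x_step_descent x x' y w : nonneg_sphere x' ->
  Proj (@nonneg_sphere R n) (y - rho^-1 *: w) x ->
  aug_lagrangian x y w <= aug_lagrangian x' y w.
Proof.
move=> Sx' [_ /(_ _ Sx') /= minx].
rewrite !aug_lagrangian_square lerD2r lerD2l ler_wpM2l ?divr_ge0 ?(ltW rho_gt0)//.
by rewrite ler_sqr ?nnegrE ?enorm_ge0.
Qed.

Lemma w_step_ascent x y w w' : w' = w + rho *: (x - y) ->
  aug_lagrangian x y w'
  = aug_lagrangian x y w + rho^-1 * enorm (w' - w) ^+ 2.
Proof.
move=> w'E; have -> : w' - w = rho *: (x - y) by rewrite w'E addrAC subrr add0r.
rewrite w'E /aug_lagrangian !enorm_sqr; move: (x - y) => u.
by rewrite !dotv_lin; field; rewrite gt_eqF.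
Qed.

(** Testing the equation [G y = w + rho (x - y)] against [y] itself: the
    nonnegative quartic term can be dropped, and the rest is a quadratic form
    bounded below by [2 * lambda_min B + rho]. *)
Lemma y_step_bound x w y : (0 < n)%N -> 0 <= alpha -> 0 <= lambda_min B ->
  enorm x = 1 -> G y = w + rho *: (x - y) ->
  (2 * lambda_min B + rho) * enorm y <= enorm w + rho.
Proof.
move=> n0 a0 l0 x1 Gy; have [y0|] := ltP 0 (enorm y); last first.
  move=> y0; apply: (@le_trans _ _ 0); last by rewrite addr_ge0 ?enorm_ge0 ?(ltW rho_gt0).
  by rewrite mulr_ge0_le0// addr_ge0 ?mulr_ge0 ?(ltW rho_gt0).
rewrite -(ler_pM2r y0) -mulrA -expr2 enorm_sqr.
have := congr1 (fun g => dotv g y) Gy; rewrite dotv_quartic_grad !dotv_lin => E.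
have p4 : 0 <= 2 * alpha * (\sum_i y i 0 ^+ 3 * y i 0).
  rewrite mulr_ge0 ?mulr_ge0// sumr_ge0// => i _.
  by rewrite -exprSr exprn_even_ge0.
have [_ /(_ y) lB] := lambda_min_eigenvalue n0 symB.
have wy := dotv_le_enorm w y.
have xy : rho * dotv x y <= rho * enorm y.
  by rewrite ler_pM2l// -[leRHS]mul1r -x1 dotv_le_enorm.
rewrite (dotvC (B *m y)) in E.
rewrite mulrDl; rewrite !mulrDl; move: p4 E lB wy xy.
rewrite -!mulrA mulrBr.
set a4 := 2 * _; lra.
Qed.

End AugmentedLagrangian.

(** * Convergence of the iteration *)

Section Limits.
Context {R : realType}.

(** The sequence [u] converges by monotonicity, so its decrements vanish, and
    they dominate [v]. *)
Lemma sufficient_descent_cvg0 (u v : nat -> R) (m : R) :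
  (forall k, m <= u k) -> (forall k, 0 <= v k) ->
  (forall k, u k.+1 + v k <= u k) -> v @ \oo --> (0 : R).
Proof.
move=> um v0 uv.
have cu : cvgn u.
  apply: nonincreasing_is_cvgn; last by exists m => _ [k _ <-].
  apply/nonincreasing_seqP => k; apply: le_trans (uv k); rewrite lerDl//.
have cdiff : (fun k => u k - u k.+1) @ \oo --> (0 : R).
  rewrite -(subrr (limn u)); apply: cvgB; first exact: cu.
  by have := cu; rewrite -(cvg_shiftS u).
apply: (squeeze_cvgr _ (cvg_cst 0) cdiff).
by apply: nearW => k; rewrite v0/= lerBrDl.
Qed.

(** Inequalities pass to cluster points by continuity, even with an error [d k]
    that only vanishes in the limit. *)
Lemma cluster_le0 (n : nat) (x : nat -> 'cV[R]_n) (p : 'cV[R]_n)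
    (psi : 'cV[R]_n -> R) (d : nat -> R) :
  cluster (x @ \oo) p -> continuous psi -> d @ \oo --> (0 : R) ->
  (forall k, psi (x k) <= d k) -> psi p <= 0.
Proof.
move=> clp cpsi d0 psid; rewrite leNgt; apply/negP => psip.
have U : nbhs p [set q | psi p / 2 < psi q].
  have /cvgr_gt/(_ (psi p / 2)) := cpsi p; apply.
  by rewrite gtr_pMr// invf_lt1// ltr1n.
have W : (x @ \oo) [set q | psi q < psi p / 2].
  have /cvgr_lt/(_ (psi p / 2)) := d0.
  rewrite divr_gt0// => /(_ isT); apply: filterS => k /=.
  exact: le_lt_trans.
have [q [/= qW qU]] := clp _ _ W U.
by have := lt_trans qW qU; rewrite ltxx.
Qed.

Lemma enorm_sub_continuous (n : nat) (p : 'cV[R]_n) :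
  continuous (fun u : 'cV[R]_n => enorm (u - p)).
Proof.
have cdot : continuous (fun u : 'cV[R]_n => dotv (u - p) (u - p)).
  under [X in continuous X]eq_fun do rewrite dotvE.
  apply: sum_continuous => i.
  under [X in continuous X]eq_fun do rewrite !mxE.
  apply: fun_continuousM; apply: fun_continuousB;
    by [exact: coord_continuous|exact: cst_continuous].
rewrite (_ : (fun _ => _) = Num.sqrt \o fun u : 'cV[R]_n => dotv (u - p) (u - p)).
  move=> u; apply: continuous_comp; first exact: cdot.
  exact: sqrt_continuous.
by apply/funext => u; rewrite enormE.
Qed.

Lemma enorm_continuous (n : nat) : continuous (@enorm R n).
Proof.
rewrite (_ : @enorm R n = fun u => enorm (u - 0)).
  exact: enorm_sub_continuous.
by apply/funext => u; rewrite subr0.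
Qed.

Lemma cvg_enorm (n : nat) (u : nat -> 'cV[R]_n) (p : 'cV[R]_n) :
  (fun k => enorm (u k - p)) @ \oo --> (0 : R) -> u @ \oo --> p.
Proof.
move=> up; apply/cvgrPdist_lt => e e0.
have /cvgr_lt/(_ e e0) := up; apply: filterS => k ke.
rewrite [`|_|]mx_normrE; apply/bigmax_ltP; split=> // -[i j] _ /=.
have := coord_le_enorm (u k - p) i; rewrite !mxE ord1 distrC.
by move=> /le_lt_trans; exact.
Qed.

(** A sequence in a compact set converges to its only cluster point. The compact
    set used is the ball of radius [2], because it has to be a neighbourhood of a
    limit that may lie on the unit sphere. *)
Lemma cvg_unique_cluster (n : nat) (u : nat -> 'cV[R]_n) :
  (forall k, enorm (u k) <= 1) ->
  (forall p q, cluster (u @ \oo) p -> cluster (u @ \oo) q -> p = q) ->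
  exists2 p, cluster (u @ \oo) p & u @ \oo --> p.
Proof.
move=> u1 clu; pose V := [set q : 'cV[R]_n | enorm q <= 2].
have cV : compact V.
  apply: (@closed_bounded_compact _ _ 2) => //.
  apply: (@closed_comp _ _ (@enorm R n) [set r | r <= 2]) => //.
  by move=> q _; exact: enorm_continuous.
have FV : \forall k \near \oo, V (u k).
  by apply: nearW => k; apply: le_trans (u1 k) _; rewrite ler1n.
have [p [_ clp]] := cV (u @ \oo) _ FV.
exists p => //.
apply: (@compact_cluster_set1 _ p (u @ \oo) V) => //; last first.
  by apply/seteqP; split=> [q clq|q ->//]; exact: clu.
have p1 : enorm p - 1 <= 0.
  have cpsi : continuous (fun q : 'cV[R]_n => enorm q - 1).
    by apply: fun_continuousB; [exact: enorm_continuous|exact: cst_continuous].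
  apply: (cluster_le0 clp cpsi (cvg_cst 0)) => k.
  by rewrite subr_le0.
have /cvgr_lt/(_ 2) := @enorm_continuous n p.
have p2 : enorm p < 2 by lra.
by move=> /(_ p2); apply: filterS => q /ltW.
Qed.

End Limits.

Section Run.
Context {R : realType} {n : nat}.
Variables (alpha D Lf rho : R) (B : 'M[R]_n).
Variables (y0 w0 : 'cV[R]_n) (x y w : nat -> 'cV[R]_n).
Hypotheses (n_gt0 : (0 < n)%N) (alpha_gt0 : 0 < alpha) (symB : B^T = B).
Hypotheses (irrB : irreducible B) (offB : forall i j, i != j -> B i j <= 0).
Hypotheses (lmin_ge0 : 0 <= lambda_min B) (D_gt1 : 1 < D).

Local Notation f := (quartic alpha B).
Local Notation G := (quartic_grad alpha B).

Hypothesis G_lip : lipschitz_const [set z : 'cV[R]_n | enorm z <= D] G Lf.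
Hypothesis rho_w0 : enorm w0 - 2 * D * lambda_min B < rho * (D - 1).
Hypothesis rho_D : 2 * D ^+ 3 * alpha
  + 2 * D * (lambda_max B - lambda_min B) < rho * (D - 1).
Hypothesis rho_Lf : 2 * (Lf + 1) < rho.
Hypothesis rho_gt : 2 * alpha + 2 * lambda_max B < rho.
Hypothesis run : ADMM f rho y0 w0 x y w.

Let psdB (u : 'cV[R]_n) : 0 <= dotv u (B *m u).
Proof.
have [_ /(_ u)] := lambda_min_eigenvalue n_gt0 symB.
by apply: le_trans; rewrite mulr_ge0 ?dotv_ge0.
Qed.

Let lmax_ge0 : 0 <= lambda_max B.
Proof. exact: lambda_max_ge0. Qed.

Let rho_gt0 : 0 < rho.
Proof.
by apply: le_lt_trans rho_gt; rewrite addr_ge0 ?mulr_ge0 ?(ltW alpha_gt0).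
Qed.

Let xS k : nonneg_sphere (x k.+1).
Proof. by have [_ _ /(_ k)[[]]] := run. Qed.

Let y_min k : argmin (aug_lagrangian alpha B rho (x k.+1) ^~ (w k)) setT (y k.+1).
Proof. by have [_ _ /(_ k)[]] := run. Qed.

Let w_step k : w k.+1 = w k + rho *: (x k.+1 - y k.+1).
Proof. by have [_ _ /(_ k)[]] := run. Qed.

(** The first-order condition of the [y]-step is the update of the
    multiplier. *)
Lemma dual_eq_grad k : w k.+1 = G (y k.+1).
Proof. by rewrite w_step (y_step_grad symB (y_min k)). Qed.

(** [y_step_bound] propagates a bound on [w j] to [y j.+1]. The first lower bound
    on [rho] starts the induction from [w0]; the second continues it, since
    [w j = G (y j)] is bounded in terms of [D] once [enorm (y j) <= D]. *)
Lemma primal_bounded k : enorm (y k.+1) <= D.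
Proof.
have next j : enorm (w j) < rho * (D - 1) + 2 * D * lambda_min B ->
    enorm (y j.+1) <= D.
  move=> wj; rewrite leNgt; apply/negP => Dy.
  have := y_step_bound symB rho_gt0 n_gt0 (ltW alpha_gt0) lmin_ge0
    (xS j).1 (y_step_grad symB (y_min j)).
  have l_gt0 : 0 < 2 * lambda_min B + rho by rewrite ltr_wpDl// mulr_ge0.
  move: Dy; rewrite -(ltr_pM2l l_gt0) => Dy H.
  have := lt_le_trans Dy H; move: wj; rewrite mulrDl mulrBr; lra.
elim: k => [|k IHk]; apply: next.
  by have [_ -> _] := run; rewrite -ltrBlDr.
rewrite dual_eq_grad.
apply: (le_lt_trans (enorm_quartic_grad_le symB _ n_gt0 (ltW alpha_gt0) psdB)).
have y3 : 2 * alpha * enorm (y k.+1) ^+ 3 <= 2 * alpha * D ^+ 3.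
  rewrite ler_pM2l ?mulr_gt0// lerXn2r ?nnegrE ?enorm_ge0//.
  exact: le_trans (enorm_ge0 _) IHk.
have y1 : 2 * lambda_max B * enorm (y k.+1) <= 2 * lambda_max B * D.
  by rewrite ler_wpM2l// mulr_ge0.
apply: le_lt_trans (lerD y3 y1) _.
rewrite -ltrBlDr; apply: le_lt_trans rho_D.
by rewrite le_eqVlt; apply/orP; left; apply/eqP; ring.
Qed.

(** In positive dimension the ball contains two distinct points. *)
Lemma lipschitz_const_ge0 : 0 <= Lf.
Proof.
pose e : 'cV[R]_n := delta_mx (Ordinal n_gt0) 0.
have e1 : enorm e = 1.
  apply/enorm_eq1; rewrite dotvE (bigD1 (Ordinal n_gt0))//= mxE !eqxx mulr1.
  by rewrite big1 ?addr0// => i /negbTE ni; rewrite mxE ni mul0r.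
have := @G_lip e 0; rewrite /= subr0 e1 mulr1.
rewrite [enorm 0]enormE dotv0l sqrtr0 (ltW D_gt1).
have -> : 0 <= D by apply: le_trans (ltW D_gt1).
by move=> /(_ isT isT); apply: le_trans; exact: enorm_ge0.
Qed.

Let gap k := enorm (y k.+2 - y k.+1).

Lemma dual_step_le k : enorm (w k.+2 - w k.+1) <= Lf * gap k.
Proof. by rewrite !dual_eq_grad; apply: G_lip; exact: primal_bounded. Qed.

(** The descent of the two primal steps, [rho / 2] times the squared step,
    dominates the ascent of the dual step, at most [Lf ^+ 2 / rho] times it. *)
Lemma primal_step_cvg0 : gap @ \oo --> (0 : R).
Proof.
have Lf0 := lipschitz_const_ge0.
(* Positive because [rho > 2 * (Lf + 1)] gives [rho ^+ 2 > 2 * Lf ^+ 2]. *)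
pose c := rho / 2 - rho^-1 * Lf ^+ 2.
have c_gt0 : 0 < c.
  rewrite /c subr_gt0 mulrC ltr_pdivrMr//.
  have : (2 * (Lf + 1)) ^+ 2 < rho ^+ 2.
    by rewrite ltr_sqr ?nnegrE ?(ltW rho_gt0)// mulr_ge0// addr_ge0.
  nra.
pose L k := aug_lagrangian alpha B rho (x k.+1) (y k.+1) (w k.+1).
pose M := 2 * alpha * D ^+ 3 + 2 * lambda_max B * D.
have cgap : (fun k => c * gap k ^+ 2) @ \oo --> (0 : R).
  apply: (@sufficient_descent_cvg0 _ L _ (- ((2 * rho)^-1 * M ^+ 2))) => k.
  - apply: le_trans (aug_lagrangian_lb rho_gt0 _ _ _ (ltW alpha_gt0) psdB).
    rewrite lerN2 ler_pM2l ?invr_gt0 ?mulr_gt0// -enorm_sqr.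
    have D0 : 0 <= D by apply: le_trans (ltW D_gt1).
    have M0 : 0 <= M.
      by rewrite addr_ge0 ?mulr_ge0 ?exprn_ge0 ?(ltW alpha_gt0).
    rewrite ler_sqr ?nnegrE ?enorm_ge0// dual_eq_grad.
    apply: le_trans (enorm_quartic_grad_le symB _ n_gt0 (ltW alpha_gt0) psdB) _.
    have yD := primal_bounded k; apply: lerD.
      rewrite ler_pM2l ?mulr_gt0// lerXn2r ?nnegrE ?enorm_ge0//.
    by rewrite ler_wpM2l// mulr_ge0.
  - by rewrite mulr_ge0 ?sqr_ge0 ?(ltW c_gt0).
  - have [_ _ /(_ k.+1)[xP _ _]] := run.
    have hx := x_step_descent alpha B rho_gt0 (xS k) xP.
    have hy := y_step_descent symB (y k.+1) (ltW alpha_gt0) psdB (y_min k.+1).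
    have hw := w_step_ascent alpha B rho_gt0 (w_step k.+1).
    have hd : rho^-1 * enorm (w k.+2 - w k.+1) ^+ 2
              <= rho^-1 * (Lf ^+ 2 * gap k ^+ 2).
      rewrite ler_pM2l ?invr_gt0// -exprMn ler_sqr ?nnegrE ?enorm_ge0//.
        exact: dual_step_le.
      by rewrite mulr_ge0 ?enorm_ge0.
    rewrite /L hw /c mulrBl -mulrA; move: hd hx hy; rewrite -/(gap k) -!mulrA.
    lra.
have -> : gap = Num.sqrt \o (fun k => c^-1 * (c * gap k ^+ 2)).
  apply/funext => k /=; rewrite mulKf ?gt_eqF// sqrtr_sqr ger0_norm//.
  exact: enorm_ge0.
rewrite -sqrtr0 -(mulr0 c^-1).
apply: continuous_cvg; first exact: sqrt_continuous.
by apply: cvgM; [exact: cvg_cst|exact: cgap].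
Qed.

(* The projection [x k.+2] is computed from [y k.+1]; the indices start there
   because [y 0] and [w 0] are arbitrary and [w 0] need not be a gradient. *)
Let lag k := enorm (y k.+1 - x k.+2).

Lemma projection_lag_cvg0 : lag @ \oo --> (0 : R).
Proof.
have lagE k : lag k <= (1 + rho^-1 * Lf) * gap k.
  rewrite /lag -(subrKA (y k.+2)); apply: le_trans (enormD _ _) _.
  rewrite mulrDl mul1r /gap -(enormN (_ - y k.+1)) opprB lerD2l.
  have -> : y k.+2 - x k.+2 = - (rho^-1 *: (w k.+2 - w k.+1)).
    rewrite [w k.+2]w_step (addrC (w _)) addrK scalerA mulVf ?gt_eqF//.
    by rewrite scale1r opprB.
  rewrite enormN enormZ ger0_norm ?invr_ge0 ?(ltW rho_gt0)// -mulrA.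
  rewrite ler_pM2l ?invr_gt0// -(opprB (y k.+2)) enormN.
  exact: dual_step_le.
have lim0 : (fun k => (1 + rho^-1 * Lf) * gap k) @ \oo --> (0 : R).
  rewrite -(mulr0 (1 + rho^-1 * Lf)).
  by apply: cvgM; [exact: cvg_cst|exact: primal_step_cvg0].
apply: (squeeze_cvgr _ (cvg_cst 0) lim0).
by apply: nearW => k; rewrite lagE enorm_ge0.
Qed.

(** The optimality condition of the projection is a variational inequality at
    the point [y - w / rho]; replacing that point by [x - G x / rho] costs a
    multiple of [lag]. *)
Lemma projection_inequality z k : nonneg_sphere z ->
  dotv (z - x k.+2) (x k.+2 - rho^-1 *: G (x k.+2))
  <= 2 * (1 + rho^-1 * Lf) * lag k.
Proof.
move=> Sz; have [_ _ /(_ k.+1)[[SX /(_ _ Sz) /= minX] _ _]] := run.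
have [z1 X1] := (proj1 (enorm_eq1 _) Sz.1, proj1 (enorm_eq1 _) SX.1).
move: minX; rewrite dual_eq_grad; set X := x k.+2 in SX X1 *.
set Y := y k.+1; set v := Y - _ => minX.
have {minX} zv : dotv (z - X) v <= 0.
  move: minX; rewrite enorm_le ?enorm_ge0// enorm_sqr.
  move: (v) => v'; rewrite !dotv_lin z1 X1 (dotvC v' z) (dotvC v' X); lra.
have zX : enorm (z - X) <= 2.
  by apply: le_trans (enormD _ _) _; rewrite enormN Sz.1 SX.1.
have XD : enorm X <= D by rewrite SX.1 ltW.
have -> : X - rho^-1 *: G X = v + ((X - Y) + rho^-1 *: (G Y - G X)).
  by apply/matrixP => i j; rewrite ord1 /v !mxE; ring.
rewrite dotvDr -[leRHS]add0r lerD//.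
apply: le_trans (dotv_le_enorm _ _) _; rewrite -mulrA.
apply: ler_pM; rewrite ?enorm_ge0//.
apply: le_trans (enormD _ _) _; rewrite mulrDl mul1r -mulrA.
rewrite -(enormN (X - Y)) opprB enormZ ger0_norm ?invr_ge0 ?(ltW rho_gt0)//.
rewrite lerD2l ler_pM2l ?invr_gt0//.
by apply: G_lip => //; exact: primal_bounded.
Qed.

Lemma quartic_grad_continuous (i : 'I_n) : continuous (fun q => G q i 0).
Proof.
under [X in continuous X]eq_fun do rewrite mxE.
apply: fun_continuousD; apply: fun_continuousM; try exact: cst_continuous.
  by apply: fun_continuousX; exact: coord_continuous.
exact: mulmx_coord_continuous.
Qed.

(** Passing to the limit in [projection_inequality] gives the fixed point
    property required by [projected_gradient_fixpoint]. *)
Lemma cluster_critical p : cluster ((fun k => x k.+2) @ \oo) p ->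
  [/\ forall i, 0 < p i 0, dotv p p = 1 & exists mu, G p = mu *: p].
Proof.
move=> clp.
have cst0 : (fun=> 0 : R) @ \oo --> (0 : R) by exact: cvg_cst.
have p_ge0 i : 0 <= p i 0.
  have cpsi : continuous (fun q : 'cV[R]_n => - q i 0).
    by move=> q; apply: continuousN; exact: coord_continuous.
  rewrite -oppr_le0; apply: (cluster_le0 clp cpsi cst0) => k.
  by rewrite oppr_le0; exact: (xS k.+1).2.
have x1 k : dotv (x k.+2) (x k.+2) = 1 by apply/enorm_eq1; exact: (xS k.+1).1.
have p1 : dotv p p = 1.
  have cle : continuous (fun q : 'cV[R]_n => dotv q q - 1).
    by apply: fun_continuousB; [exact: dotv_continuous|exact: cst_continuous].
  have cge : continuous (fun q : 'cV[R]_n => 1 - dotv q q).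
    by apply: fun_continuousB; [exact: cst_continuous|exact: dotv_continuous].
  apply/eqP; rewrite eq_le -subr_le0 -[X in _ && X]subr_le0; apply/andP; split.
    by apply: (cluster_le0 clp cle cst0) => k; rewrite x1 subrr.
  by apply: (cluster_le0 clp cge cst0) => k; rewrite x1 subrr.
suff pmax z : nonneg_sphere z ->
    dotv z (p - rho^-1 *: G p) <= dotv p (p - rho^-1 *: G p).
  have [p_gt0 [mu Gp]] := projected_gradient_fixpoint alpha_gt0 symB offB
    irrB rho_gt rho_gt0 n_gt0 p1 p_ge0 pmax.
  by split=> //; exists mu.
move=> Sz; rewrite -subr_le0 -dotvNl -dotvDl.
have lim0 : (fun k => 2 * (1 + rho^-1 * Lf) * lag k) @ \oo --> (0 : R).
  rewrite -(mulr0 (2 * (1 + rho^-1 * Lf))).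
  by apply: cvgM; [exact: cvg_cst|exact: projection_lag_cvg0].
have subE (q : 'cV[R]_n) (i : 'I_n) : (z - q) i 0 * (q - rho^-1 *: G q) i 0
    = (z i 0 - q i 0) * (q i 0 - rho^-1 * G q i 0).
  by rewrite !mxE.
have cpsi : continuous (fun q : 'cV[R]_n => dotv (z - q) (q - rho^-1 *: G q)).
  under [X in continuous X]eq_fun do rewrite dotvE.
  apply: sum_continuous => i.
  under [X in continuous X]eq_fun do rewrite subE.
  apply: fun_continuousM; apply: fun_continuousB;
    [exact: cst_continuous|exact: coord_continuous|exact: coord_continuous|].
  by apply: fun_continuousM; [exact: cst_continuous|exact: quartic_grad_continuous].
apply: (cluster_le0 clp cpsi lim0) => k; exact: projection_inequality.
Qed.

Lemma ADMM_converges : exists xs ys ws : 'cV[R]_n,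
  [/\ x @ \oo --> xs, y @ \oo --> ys, w @ \oo --> ws
    & argmin f [set z : 'cV[R]_n | enorm z ^+ 2 = 1] ys].
Proof.
have [k|p q clp clq|p clp xp] := @cvg_unique_cluster _ _ (fun k => x k.+2).
- by rewrite (xS k.+1).1.
- have [p0 p1 [mu Gp]] := cluster_critical clp.
  have [q0 q1 [nu Gq]] := cluster_critical clq.
  exact: (positive_critical_unique alpha_gt0 symB offB p0 q0 Gp Gq).
have [p0 p1 [mu Gp]] := cluster_critical clp.
have xp0 : (fun k => enorm (x k.+2 - p)) @ \oo --> (0 : R).
  have -> : 0 = enorm (p - p) by rewrite subrr enormE dotv0l sqrtr0.
  exact: (cvg_comp _ _ xp (@enorm_sub_continuous _ _ p p)).
have yp0 : (fun k => enorm (y k.+1 - p)) @ \oo --> (0 : R).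
  have lim0 : (fun k => lag k + enorm (x k.+2 - p)) @ \oo --> (0 : R).
    by rewrite -(addr0 0); apply: cvgD; [exact: projection_lag_cvg0|].
  apply: (squeeze_cvgr _ (cvg_cst 0) lim0); apply: nearW => k.
  by rewrite enorm_ge0/= /lag -(subrKA (x k.+2)) enormD.
have wp0 : (fun k => enorm (w k.+1 - G p)) @ \oo --> (0 : R).
  have lim0 : (fun k => Lf * enorm (y k.+1 - p)) @ \oo --> (0 : R).
    by rewrite -(mulr0 Lf); apply: cvgM; [exact: cvg_cst|].
  apply: (squeeze_cvgr _ (cvg_cst 0) lim0); apply: nearW => k.
  rewrite enorm_ge0/= dual_eq_grad; apply: G_lip; first exact: primal_bounded.
  by rewrite /= (proj2 (enorm_eq1 p) p1) ltW.
exists p, p, (G p); split.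
- by rewrite -(cvg_shiftn 2) (_ : (fun k => _) = fun k => x k.+2)//;
    apply/funext => k; rewrite addn2.
- by rewrite -(cvg_shiftS y); exact: cvg_enorm.
- by rewrite -(cvg_shiftS w); exact: cvg_enorm.
split=> [|z]; rewrite /= enorm_sqr// => z1.
apply: le_trans (positive_critical_gap symB offB p0 Gp p1 z1).
rewrite lerDl mulr_ge0 ?divr_ge0 ?(ltW alpha_gt0)// sumr_ge0// => i _.
exact: sqr_ge0.
Qed.

End Run.

(** * The convergence theorem *)

Theorem theorem4p5 (R : realType) (n : nat) (alpha D Lf rho : R)
    (B : 'M[R]_n) (y0 w0 : 'cV[R]_n) (x y w : nat -> 'cV[R]_n)
    (n_gt0 : (0 < n)%N)
    (alpha_gt0 : 0 < alpha)
    (B_sym : B^T = B)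
    (B_irr : irreducible B)
    (B_M : M_matrix B)
    (D_gt1 : 1 < D)
    (Lf_lip : lipschitz_const [set z : 'cV[R]_n | enorm z <= D]
                (grad (quartic alpha B)) Lf)
    (rho_gt : Num.max ((enorm w0 - 2 * D * lambda_min B) / (D - 1))
               (Num.max ((2 * D ^+ 3 * alpha
                          + 2 * D * (lambda_max B - lambda_min B)) / (D - 1))
                 (Num.max (2 * (Lf + 1))
                          (2 * alpha + 2 * lambda_max B)))
              < rho)
    (xyw_ADMM : ADMM (quartic alpha B) rho y0 w0 x y w) :
  exists xs ys ws : 'cV[R]_n,
    [/\ x @ \oo --> xs, y @ \oo --> ys, w @ \oo --> ws
      & argmin (quartic alpha B) [set z : 'cV[R]_n | enorm z ^+ 2 = 1] ys].
Proof.
have lmin_ge0 := M_matrix_lambda_min_ge0 n_gt0 B_sym B_M.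
have D1 : 0 < D - 1 by rewrite subr_gt0.
move: rho_gt; rewrite !gt_max !ltr_pdivrMr// => /and4P[rho_w0 rho_D rho_Lf rho_l].
have G_lip : lipschitz_const [set z : 'cV[R]_n | enorm z <= D]
    (quartic_grad alpha B) Lf.
  by move=> u v Du Dv; rewrite -!grad_quartic//; exact: Lf_lip.
have offB i j : i != j -> B i j <= 0 by exact: M_matrix_offdiag.
exact: (ADMM_converges n_gt0 alpha_gt0 B_sym B_irr offB lmin_ge0 D_gt1 G_lip
  rho_w0 rho_D rho_Lf rho_l xyw_ADMM).
Qed.
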